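(* Let $q$ be an odd prime power, let $d$ be odd, and let $i \in \{3,4\}$. Let $R \subseteq \mathbb{F}_q^\times$ be such that $(-1)^{i+1}\eta(-r) = -1$ for every $r \in R$. Let $P \subseteq \mathbb{F}_q^d$, and let $S$ be a set of $Q_i^d$-spheres whose radii all lie in $R$. Then \[\left|I(P,S) - q^{-1}|P|\,|S|\right| \leq q^{(d-1)/2}|P|^{1/2}|S|^{1/2} + \sqrt{3}\,q^{(d-3)/4}|P|^{1/2}|S|.\]
   Context: $\mathbb{F}_q$ is the finite field with $q$ elements, $\mathbb{F}_q^\times = \mathbb{F}_q\setminus\{0\}$, and $\eta$ is the quadratic character: $\eta(0)=0$, $\eta(x)=1$ if $x$ is a non-zero square, $\eta(x)=-1$ if $x$ is a non-square. Fix a non-square $\epsilon\in\mathbb{F}_q$. For odd $d$, define quadratic forms on $\mathbb{F}_q^d$ by $Q_3^d(x) = x_1x_2 + x_3x_4 + \cdots + x_{d-2}x_{d-1} - x_d^2$ and $Q_4^d(x) = x_1x_2 + x_3x_4 + \cdots + x_{d-2}x_{d-1} - \epsilon x_d^2$. For a quadratic form $Q$, the $Q$-sphere with center $y$ and radius $r$ is $\{x \in \mathbb{F}_q^d : Q(x-y) = r\}$; a sphere is specified by its center and radius. For $P \subseteq \mathbb{F}_q^d$ and a set $S$ of spheres, $I(P,S) = \#\{(x,s) \in P \times S : x \in s\}$. *)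

(* Defs.v *)
From mathcomp Require Import all_boot all_algebra.
Set Implicit Arguments.
Unset Strict Implicit.
Unset Printing Implicit Defensive.
Import GRing.Theory.
Local Open Scope ring_scope.

Definition is_square (F : finFieldType) (x : F) : bool :=
  [exists y : F, x == y ^+ 2].

(* Quadratic character, integer valued. *)
Definition eta (F : finFieldType) (x : F) : int :=
  if x == 0 then 0 else if is_square x then 1 else -1.

(* x_1 x_2 + x_3 x_4 + ... + x_{d-2} x_{d-1} - c x_d^2, for odd d.
   Coordinates are indexed from 0: the pairs are the (i, i+1) with i even and
   i+1 < d, and the last coordinate is the i with i+1 = d. *)
Definition Qform (F : finFieldType) (d : nat) (c : F) (x : 'rV[F]_d) : F :=
  \sum_(i < d | ~~ odd i) \sum_(j < d | j == i.+1 :> nat) x 0 i * x 0 j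
  - c * \sum_(i < d | i.+1 == d) x 0 i ^+ 2.

Definition Q3 (F : finFieldType) (d : nat) : 'rV[F]_d -> F := Qform 1.
Definition Q4 (F : finFieldType) (d : nat) (eps : F) : 'rV[F]_d -> F :=
  Qform eps.

(* Q_i for i in {3, 4}; the value at other i is irrelevant. *)
Definition Qi (F : finFieldType) (d : nat) (eps : F) (i : nat) :
    'rV[F]_d -> F :=
  if i == 3%N then @Q3 F d else Q4 eps.

(* A sphere is the pair (center, radius), so spheres with the same points but
   different centers or radii are distinct. *)
Definition Qsphere (F : finFieldType) (d : nat) : finType := ('rV[F]_d * F)%type.
Definition Qcenter (F : finFieldType) (d : nat) (s : Qsphere F d) := s.1.
Definition Qradius (F : finFieldType) (d : nat) (s : Qsphere F d) := s.2.

Definition Qsphere_points (F : finFieldType) (d : nat) (Q : 'rV[F]_d -> F)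
    (s : Qsphere F d) : {set 'rV[F]_d} :=
  [set x | Q (x - Qcenter s) == Qradius s].

Definition incidences (F : finFieldType) (d : nat) (Q : 'rV[F]_d -> F)
    (P : {set 'rV[F]_d}) (S : {set Qsphere F d}) : nat :=
  #|[set u in setX P S | u.1 \in Qsphere_points Q u.2]|.

(* Main.v *)
Require Import Defs.
From mathcomp Require Import all_boot all_order all_algebra all_field.
From mathcomp Require Import ring.
From mathcomp Require Import reals exp.
(* Write d = 2n + 1 and let c be the coefficient of the anisotropic part, c = 1 or eps; the condition on the radii says that -c r is a non-square.  By Cauchy-Schwarz over the points of P, it is enough to bound the variance over all x of the number of spheres through x, hence to know the size of a sphere and to bound the size of an intersection of two spheres.  A sphere with -c r non-square has exactly q^(2n) - q^n points.  Subtracting the equations of two spheres with distinct centers leaves a hyperplane section of a sphere, which has at most q^(2n-1) + q^(n-1) points; the variance is then at most q^(2n) |S| + 3 q^(n-1) |S|^2. *)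

Set Implicit Arguments.
Unset Strict Implicit.
Unset Printing Implicit Defensive.
Import Order.TTheory GRing.Theory Num.Theory.
Local Open Scope ring_scope.

(** * Odd characteristic and sums over a finite field *)

Lemma odd_card_two_neq0 (F : finFieldType) : odd #|F| -> 2 != 0 :> F.
Proof.
move=> oddF; apply/negP => /eqP two0.
have ch2 : 2%N \in [pchar F] by rewrite inE /= two0 eqxx.
have := card_pprimeChar ch2; rewrite /pPrimeCharType => cardF.
move: oddF; rewrite cardF oddX /= orbF => /eqP log0.
by have := finNzRing_gt1 F; rewrite cardF log0.
Qed.

Section FieldSums.

Variable F : finFieldType.
Implicit Types (a b r s t : F) (f : F -> int).

Lemma sum_delta f a : \sum_s (a == s)%:R * f s = f a.
Proof.
rewrite (bigD1 a) //= eqxx mul1r big1 ?addr0 // => s.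
by rewrite eq_sym => /negPf->; rewrite mul0r.
Qed.

Lemma sum_fibers (T : finType) (h : T -> F) :
  \sum_s \sum_x (h x == s)%:R = #|T|%:R :> int.
Proof.
rewrite exchange_big (eq_bigr (fun=> 1)) ?sumr_const // => x _.
by under eq_bigr do rewrite -[_%:R]mulr1; rewrite (sum_delta (fun=> 1)).
Qed.

Lemma sum_affine f a b : a != 0 -> \sum_s f (b + a * s) = \sum_s f s.
Proof.
move=> a0; symmetry; apply: (@reindex_inj _ _ _ _ (fun s => b + a * s)).
by move=> s t /addrI /(mulfI a0).
Qed.

(** For s = 0 the inner sum is constant; for each of the other q - 1 values of s, the map t -> r + s
    t permutes the field. *)
Lemma sum_hyperbolic f r :
  \sum_s \sum_t f (r + s * t) = #|F|%:R * f r + (#|F|%:R - 1) * \sum_s f s.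
Proof.
rewrite (bigD1 0) //=; congr (_ + _).
  under eq_bigr do rewrite mul0r addr0.
  by rewrite sumr_const mulr_natl.
rewrite (eq_bigr (fun=> \sum_s f s)) => [|s s0]; last exact: sum_affine.
rewrite sumr_const -[LHS]mulr_natl; congr (_ * _).
by rewrite (cardC1 (0 : F)) -subn1 natrB // ltnW // finNzRing_gt1.
Qed.

Hypothesis two_neq0 : 2 != 0 :> F.

(** Replacing s by s + t turns s^2 - t^2 into s (s + 2 t); as 2 and k are invertible, rescaling
    reduces this to a product of two free coordinates. *)
Lemma sum_difference_of_squares f r k : k != 0 ->
  \sum_s \sum_t f (r + k * (s ^+ 2 - t ^+ 2))
    = #|F|%:R * f r + (#|F|%:R - 1) * \sum_s f s.
Proof.
move=> k0; rewrite -sum_hyperbolic exchange_big /=.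
transitivity (\sum_t \sum_s f (r + k * (s * (s + 2 * t)))).
  apply: eq_bigr => t _.
  rewrite -(sum_affine (fun s => f (r + k * (s ^+ 2 - t ^+ 2))) t (oner_neq0 F)).
  by apply: eq_bigr => s _; congr (f _); ring.
rewrite exchange_big /= -(sum_affine (fun s => \sum_t f (r + s * t)) 0 k0).
apply: eq_bigr => s _.
rewrite -(sum_affine (fun t => f (r + (0 + k * s) * t)) s two_neq0).
by apply: eq_bigr => t _; congr (f _); ring.
Qed.

End FieldSums.

(** * Points on an affine conic *)

Section Conics.

Variable F : finFieldType.
Hypothesis two_neq0 : 2 != 0 :> F.

(* Stereographic projection from a point p of the conic: each of the q + 1 lines through p meets the conic in at most one further point, and p itself is the further point of its tangent line. *)
Lemma card_conic (a b c : F) : a != 0 -> b != 0 -> c != 0 ->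
  (#|[set p : F * F | (a * p.1 ^+ 2 + b * p.2 ^+ 2 == c)%R]| <= #|F|.+1)%N.
Proof.
move=> a0 b0 c0.
have [->|[[u0 s0]]] := set_0Vmem [set p : F * F | a * p.1 ^+ 2 + b * p.2 ^+ 2 == c].
  by rewrite cards0.
rewrite inE /= => /eqP p0C.
(* The line of slope k through p meets the conic again at horizontal distance [step k]; [None]
   stands for the vertical line. A vanishing denominator gives [step k = 0], which is harmless
   because only a covering of the conic is needed. *)
pose step k := - (2 * (a * u0 + b * s0 * k)) / (a + b * k ^+ 2).
pose point l := if l is Some k then (u0 + step k, s0 + k * step k) else (u0, - s0).
apply: leq_trans (_ : #|[set point l | l : option F]| <= _)%N; last first.
  by rewrite (leq_trans (leq_imset_card _ _)) // card_option.
apply: subset_leq_card; apply/subsetP => -[u s]; rewrite inE /= => /eqP pC.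
apply/imsetP; have [uu0|uu0] := eqVneq u u0.
  have /eqP : b * ((s - s0) * (s + s0)) = 0.
    by rewrite -(subrr c) -{1}pC -p0C uu0; ring.
  rewrite mulf_eq0 (negPf b0) /= mulf_eq0 subr_eq0 addr_eq0.
  have [ss0 _|_ /= /eqP ss0] := eqVneq s s0; last first.
    by exists None; rewrite //= uu0 ss0.
  (* The tangent at p is vertical if s0 = 0; otherwise its slope is the one that kills the numerator
     of [step]. *)
  have [s00|s00] := eqVneq s0 0.
    by exists None; rewrite //= uu0 ss0 s00 oppr0.
  exists (Some (- (a * u0) / (b * s0))) => //=.
  have -> : step (- (a * u0) / (b * s0)) = 0.
    rewrite /step (_ : _ + _ * (_ / _) = 0); first by rewrite mulr0 oppr0 mul0r.
    by field; rewrite b0 s00.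
  by rewrite uu0 ss0 mulr0 !addr0.
have du0 : u - u0 != 0 by rewrite subr_eq0.
pose k := (s - s0) / (u - u0).
have sE : s = s0 + k * (u - u0) by rewrite /k divfK // addrC subrK.
have line : (a + b * k ^+ 2) * (u - u0) = - (2 * (a * u0 + b * s0 * k)).
  apply: (mulfI du0); apply/eqP; rewrite -subr_eq0; apply/eqP.
  by rewrite -(subrr c) -{1}pC -p0C sE; ring.
clearbody k; exists (Some k) => //.
(* If a + b k^2 = 0, then [line] forces s0 = k u0, whence c = (a + b k^2) u0^2 = 0. *)
have den0 : a + b * k ^+ 2 != 0.
  apply: contraNneq c0 => den0.
  have k0 : k != 0.
    by apply: contraNneq a0 => k0; rewrite -den0 k0 expr0n mulr0 addr0.
  have aE : a = - (b * k ^+ 2) by apply/eqP; rewrite -addr_eq0 den0.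
  have /eqP : 2 * (b * k) * (s0 - k * u0) = 0.
    by apply: oppr_inj; rewrite oppr0 -[RHS](mul0r (u - u0)) -den0 line aE; ring.
  rewrite !mulf_eq0 (negPf two_neq0) (negPf b0) (negPf k0) /= subr_eq0.
  by move=> /eqP s0E; rewrite -p0C s0E aE; apply/eqP; ring.
have -> : point (Some k) = (u0 + (u - u0), s0 + k * (u - u0)).
  by rewrite /point; have -> : step k = u - u0 by rewrite /step -line mulrAC divff ?mul1r.
by rewrite -sE addrC subrK.
Qed.

End Conics.

(** * Hyperplane sections of a non-degenerate quadric *)

Lemma sum_indicator (A : nzRingType) (T : finType) (P : pred T) :
  \sum_x (P x)%:R = #|[set x | P x]|%:R :> A.
Proof.
rewrite -sum1dep_card natr_sum [RHS]big_mkcond /=.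
by apply: eq_bigr => x _; case: (P x).
Qed.

Record nondegenerate_form (F : finFieldType) (d : nat) (Q : 'rV[F]_d -> F)
    (B : 'rV[F]_d -> 'rV[F]_d -> F) : Prop := NondegenerateForm {
  quadD : forall x v k, Q (x + k *: v) = Q x + k * B x v + k ^+ 2 * Q v;
  polarD : forall x y v k, B (x + k *: y) v = B x v + k * B y v;
  polar_diag : forall v, B v v = 2 * Q v;
  polar_nondeg : forall v, v != 0 -> exists w, B w v != 0 }.

Section QuadricSections.

Variables (F : finFieldType) (d n : nat) (c : F).
Variables (Q : 'rV[F]_d -> F) (B : 'rV[F]_d -> 'rV[F]_d -> F).
Hypothesis QB : nondegenerate_form Q B.
Hypothesis two_neq0 : 2 != 0 :> F.
Hypothesis c_neq0 : c != 0.
Hypothesis dE : d = n.*2.+1.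

Let q : int := #|F|%:R.

Definition quadric_count (r : F) : int := \sum_x (Q x == r)%:R.
Definition section_count (v : 'rV[F]_d) (r t : F) : int :=
  \sum_x ((Q x == r) && (B x v == t))%:R.
Definition hyperplane_count (v : 'rV[F]_d) (t : F) : int :=
  \sum_x (B x v == t)%:R.

(** The sum over t is 1 + eta(-c r), so this is the classical count q^(2n) + q^n eta(-c r). For the
    standard form it is [quadric_count_Qform]. *)
Hypothesis quadric_countE : forall r,
  quadric_count r = q ^+ n.*2 - q ^+ n + q ^+ n * \sum_t (- c * t ^+ 2 == r)%:R.

Lemma q_gt0 : 0 < q.
Proof. by rewrite /q ltr0n ltnW // finNzRing_gt1. Qed.

Lemma sum_section_count v r : \sum_t section_count v r t = quadric_count r.
Proof.
rewrite exchange_big; apply: eq_bigr => x _.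
under eq_bigr => t _ do rewrite andbC -mulnb natrM.
by rewrite (sum_delta (fun=> _)).
Qed.

Lemma sum_section_count_radius v t :
  \sum_r section_count v r t = hyperplane_count v t.
Proof.
rewrite exchange_big; apply: eq_bigr => x _.
under eq_bigr => r _ do rewrite -mulnb natrM.
by rewrite (sum_delta (fun=> _)).
Qed.

(** Translation by k v is a bijection that shifts both equations by constants on the section. It
    serves to vary the radius when Q v = 0, and to bring t to 0 when Q v is nonzero. *)
Lemma section_count_shift v r t k :
  section_count v r t
    = section_count v (r + k * t + k ^+ 2 * Q v) (t + 2 * k * Q v).
Proof.
rewrite [RHS](reindex_inj (addIr (k *: v))); apply: eq_bigr => x _.
rewrite (quadD QB) (polarD QB) (polar_diag QB); congr (nat_of_bool _)%:R.
rewrite mulrCA mulrA (inj_eq (addIr _)) (inj_eq (addIr (2 * k * Q v))).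
by case: (B x v =P t) => [->|]; rewrite ?andbF // (inj_eq (addIr (k * t))).
Qed.

(** Translations along a w with B(w, v) nonzero carry any of the q parallel hyperplanes to any
    other. *)
Lemma hyperplane_countE v t : v != 0 -> hyperplane_count v t = q ^+ n.*2.
Proof.
move=> /(polar_nondeg QB)[w Bw0].
have const s : hyperplane_count v s = hyperplane_count v t.
  rewrite /hyperplane_count [RHS](reindex_inj (addIr (((t - s) / B w v) *: w))).
  apply: eq_bigr => x _; rewrite (polarD QB) divfK //.
  by rewrite -(inj_eq (addIr (t - s)) _ s) subrKC.
have : q * hyperplane_count v t = q * q ^+ n.*2.
  transitivity (\sum_s hyperplane_count v s).
    by rewrite (eq_bigr _ (fun s _ => const s)) sumr_const mulr_natl.
  by rewrite sum_fibers card_mx mul1n dE expnS natrM natrX.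
by move/(mulfI (lt0r_neq0 q_gt0)).
Qed.

(* Translation along v preserves the hyperplane B(x, v) = t and shifts Q by multiples of t, so that all radii are equally frequent. *)
Lemma isotropic_section_count v r t : v != 0 -> Q v = 0 -> t != 0 ->
  q * section_count v r t = q ^+ n.*2.
Proof.
move=> v0 Qv t0; rewrite -(hyperplane_countE t v0) -sum_section_count_radius.
rewrite (eq_bigr (fun=> section_count v r t)) ?sumr_const ?mulr_natl // => s _.
rewrite [RHS](section_count_shift _ _ _ ((s - r) / t)) Qv divfK // !mulr0 !addr0.
by rewrite subrKC.
Qed.

(** The q - 1 sections with nonzero t have known size; the rest of the quadric is the section t =
    0. *)
Lemma isotropic_section_count0 v r : v != 0 -> Q v = 0 ->
  q * section_count v r 0 = q * quadric_count r - (q - 1) * q ^+ n.*2.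
Proof.
move=> v0 Qv; rewrite -(sum_section_count v r) [in RHS](bigD1 0) //= mulrDr.
have -> : (q - 1) * q ^+ n.*2 = \sum_(t | t != 0) q * section_count v r t.
  rewrite (eq_bigr (fun=> q ^+ n.*2)) => [|t t0]; last exact: isotropic_section_count.
  by rewrite sumr_const (cardC1 (0 : F)) -subn1 -mulr_natl natrB // ltnW // finNzRing_gt1.
by rewrite -mulr_sumr addrK.
Qed.

(* Completing the square gives N(r) = sum_t g(r - k t^2), with g the section counts; convolving once more with k s^2 produces the hyperbolic plane k (s^2 - t^2), whose known solution counts allow one to solve for g. *)
Lemma anisotropic_section_count v m : v != 0 -> Q v != 0 ->
  q * section_count v m 0 = q ^+ n.*2 + q ^+ n *
    (#|[set p : F * F | c * p.1 ^+ 2 + (4 * Q v)^-1 * p.2 ^+ 2 == - m]|%:R - q).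
Proof.
move=> v0 Qv0; set k := (4 * Q v)^-1.
have four0 : 4 != 0 :> F by rewrite (natrM _ 2 2) mulf_neq0.
have k0 : k != 0 by rewrite invr_eq0 mulf_neq0.
have quadric_section r :
    quadric_count r = \sum_t section_count v (r - k * t ^+ 2) 0.
  rewrite -(sum_section_count v); apply: eq_bigr => t _.
  rewrite (section_count_shift _ _ _ (- (t / (2 * Q v)))).
  by congr section_count; rewrite /k; field; rewrite ?two_neq0 ?Qv0 ?four0.
have := sum_difference_of_squares two_neq0 (section_count v ^~ 0) m k0.
rewrite sum_section_count_radius hyperplane_countE // -/q.
have -> : \sum_s \sum_t section_count v (m + k * (s ^+ 2 - t ^+ 2)) 0
    = \sum_s quadric_count (m + k * s ^+ 2).
  apply: eq_bigr => s _; rewrite quadric_section; apply: eq_bigr => t _.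
  by congr section_count; ring.
rewrite (eq_bigr _ (fun s _ => quadric_countE _)) big_split /= sumr_const.
rewrite -mulr_sumr exchange_big pair_big /=.
rewrite (sum_indicator _ (fun p => - c * p.1 ^+ 2 == m + k * p.2 ^+ 2)).
have -> : [set p : F * F | - c * p.1 ^+ 2 == m + k * p.2 ^+ 2]
    = [set p : F * F | c * p.1 ^+ 2 + k * p.2 ^+ 2 == - m].
  apply/setP => p; rewrite !inE -subr_eq0 -[RHS]subr_eq0 -[RHS]oppr_eq0.
  by congr (_ == _); ring.
rewrite -[(_ - _) *+ _]mulr_natl -/q => E.
by rewrite -[LHS](addrK ((q - 1) * q ^+ n.*2)) -E; ring.
Qed.

(* When the section is a cone over a degenerate conic, the hypothesis on r makes that conic a single point instead of a pair of lines. *)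
Lemma section_count_le v r t : v != 0 -> r != 0 -> ~~ is_square (- (c * r)) ->
  q * section_count v r t <= q ^+ n.*2 + q ^+ n.
Proof.
move=> v0 r0 nsq.
have qn0 m : 0 <= q ^+ m by rewrite exprn_ge0 // ltW // q_gt0.
have [Qv|Qv0] := eqVneq (Q v) 0.
  have [->|t0] := eqVneq t 0; last first.
    by rewrite isotropic_section_count // lerDl.
  (* A solution of - c s^2 = r would make -(c r) = (c s)^2 a square, so the sum over s vanishes. *)
  rewrite isotropic_section_count0 // quadric_countE big1 ?mulr0 ?addr0; last first.
    move=> s _; have [rE|//] := eqVneq.
    by case/existsP: nsq; exists (c * s); rewrite -rE; apply/eqP; ring.
  rewrite (_ : _ - _ = q ^+ n.*2 - q * q ^+ n); last by ring.
  by rewrite lerD2l (le_trans _ (qn0 n)) // oppr_le0 mulr_ge0 // ltW // q_gt0.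
rewrite (section_count_shift _ _ _ (- (t / (2 * Q v)))).
set m := r + _ + _; rewrite (_ : _ + _ = 0); last by field; rewrite Qv0.
rewrite anisotropic_section_count // lerD2l -[leRHS]mulr1 ler_wpM2l //.
rewrite lerBlDr /q nat1r ler_nat.
have four0 : 4 != 0 :> F by rewrite (natrM _ 2 2) mulf_neq0.
have [m0|m0] := eqVneq m 0; last first.
  by apply: card_conic; rewrite ?oppr_eq0 ?invr_eq0 ?mulf_neq0.
suff /subset_leq_card : [set p : F * F | c * p.1 ^+ 2 + (4 * Q v)^-1 * p.2 ^+ 2 == - m]
    \subset [set (0, 0)].
  by rewrite cards1 => /leq_trans; apply.
apply/subsetP => -[u s]; rewrite inE /= m0 oppr0 inE => /eqP conic0.
have tE : t ^+ 2 = 4 * Q v * r.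
  apply/eqP; rewrite -subr_eq0; apply/eqP.
  by rewrite -[RHS](mulr0 (- (4 * Q v))) -m0 /m; field; rewrite Qv0.
(* Multiply the conic equation by 4 Q(v) r^2 and use t^2 = 4 Q(v) r, which is m = 0. The coefficient
   -(c r) is a non-square, so u t must vanish. *)
have sE : (s * r) ^+ 2 = - (c * r) * (u * t) ^+ 2.
  rewrite [in RHS]exprMn tE; apply/eqP; rewrite -subr_eq0; apply/eqP.
  by rewrite -[RHS](mulr0 (4 * Q v * r ^+ 2)) -conic0; field; rewrite Qv0.
have t0 : t != 0 by rewrite -sqrf_eq0 tE !mulf_neq0.
have u0 : u = 0.
  apply: contraNeq nsq => u0; apply/existsP; exists (s * r / (u * t)).
  by rewrite expr_div_n sE mulfK // expf_neq0 // mulf_neq0.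
move: sE; rewrite u0 mul0r expr0n mulr0 => /eqP; rewrite sqrf_eq0 mulf_eq0.
by rewrite (negPf r0) orbF => /eqP ->.
Qed.

End QuadricSections.

(** * The standard form, built up one hyperbolic plane at a time *)

Section StandardForm.

Variable F : finFieldType.

Definition tail2 (d : nat) (x : 'rV[F]_d.+2) : 'rV[F]_d :=
  \row_j x 0 (lift ord0 (lift ord0 j)).

Definition cons2 (d : nat) (a b : F) (y : 'rV[F]_d) : 'rV[F]_d.+2 :=
  \row_j if unlift ord0 j is Some j1 then
           if unlift ord0 j1 is Some j2 then y 0 j2 else b
         else a.

Lemma cons2_0 d a b (y : 'rV[F]_d) : cons2 a b y 0 ord0 = a.
Proof. by rewrite mxE unlift_none. Qed.

Lemma cons2_1 d a b (y : 'rV[F]_d) : cons2 a b y 0 (lift ord0 ord0) = b.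
Proof. by rewrite mxE liftK unlift_none. Qed.

Lemma tail2_cons2 d a b (y : 'rV[F]_d) : tail2 (cons2 a b y) = y.
Proof. by apply/rowP => j; rewrite !mxE !liftK. Qed.

Lemma cons2_tail2 d (x : 'rV[F]_d.+2) :
  cons2 (x 0 ord0) (x 0 (lift ord0 ord0)) (tail2 x) = x.
Proof.
apply/rowP => j; rewrite mxE; case: unliftP => [j1|] -> //.
by case: unliftP => [j2|] -> //; rewrite mxE.
Qed.

Lemma tail2_lin d (x y : 'rV[F]_d.+2) k :
  tail2 (x + k *: y) = tail2 x + k *: tail2 y.
Proof. by apply/rowP => j; rewrite !mxE. Qed.

Lemma big_cons2 (A : nmodType) d (f : 'rV[F]_d.+2 -> A) :
  \sum_x f x = \sum_a \sum_b \sum_y f (cons2 a b y).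
Proof.
rewrite pair_big pair_big /=.
rewrite (reindex (fun p : F * F * 'rV[F]_d => cons2 p.1.1 p.1.2 p.2)) //=.
exists (fun x : 'rV[F]_d.+2 => (x 0 ord0, x 0 (lift ord0 ord0), tail2 x)).
  by move=> [[a b] y] _ /=; rewrite cons2_0 cons2_1 tail2_cons2.
by move=> x _; rewrite cons2_tail2.
Qed.

(** A shift by two preserves parity and adjacency of indices; 0 < d keeps the squared last
    coordinate in the tail. *)
Lemma Qform_tail2 d c (x : 'rV[F]_d.+2) : (0 < d)%N ->
  Qform c x = x 0 ord0 * x 0 (lift ord0 ord0) + Qform c (tail2 x).
Proof.
move=> d0; rewrite /Qform addrA; congr (_ - c * _).
  rewrite big_mkcond big_ord_recl big_ord_recl /= add0r; congr (_ + _).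
    by rewrite big_mkcond big_ord_recl big_ord_recl /= add0r big1 ?addr0.
  rewrite [RHS]big_mkcond; apply: eq_bigr => i _ /=; rewrite negbK.
  case: ifP => // _; rewrite big_mkcond big_ord_recl big_ord_recl /= !add0r.
  rewrite [RHS]big_mkcond; apply: eq_bigr => j _ /=.
  by rewrite !mxE /= !eqSS.
rewrite big_mkcond big_ord_recl big_ord_recl /= !eqSS.
rewrite eq_sym eqn0Ngt d0 !add0r [RHS]big_mkcond.
by apply: eq_bigr => i _; rewrite !mxE /= !eqSS.
Qed.

Lemma Qform1 c (x : 'rV[F]_1) : Qform c x = - c * x 0 0 ^+ 2.
Proof.
rewrite /Qform big_mkcond /= big_ord1 /= big_pred0; last first.
  by move=> j; rewrite (ord1 j).
by rewrite add0r big_mkcond big_ord1 /= mulNr.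
Qed.

(** If one of the first two coordinates of v is nonzero, the opposite basis vector of that
    hyperbolic plane detects it; otherwise the tail is nonzero and induction applies. *)
Lemma nondegenerate_Qform n c : 2 != 0 :> F -> c != 0 ->
  exists B, nondegenerate_form (@Qform F n.*2.+1 c) B.
Proof.
move=> two0 c0; elim: n => [|n [B [QD BD BQ Bnz]]].
  exists (fun x y : 'rV[F]_1 => - (2 * c) * (x 0 0 * y 0 0)).
  split=> [x v k|x y v k|v|v v0]; rewrite ?Qform1 ?mxE; try ring.
  exists v; have [v00|v00] := eqVneq (v 0 0) 0.
    by case/eqP: v0; apply/rowP => j; rewrite (ord1 j) v00 mxE.
  by rewrite !mulf_neq0 // oppr_eq0 mulf_neq0.
exists (fun x y : 'rV[F]_n.*2.+3 => x 0 ord0 * y 0 (lift ord0 ord0)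
                   + x 0 (lift ord0 ord0) * y 0 ord0 + B (tail2 x) (tail2 y)).
split=> [x v k|x y v k|v|v v0].
- by rewrite !Qform_tail2 // tail2_lin QD !mxE; ring.
- by rewrite tail2_lin BD !mxE; ring.
- by rewrite BQ Qform_tail2 //; ring.
have B0 y : B 0 y = 0.
  by rewrite -[0](subrr 0) -scaleN1r BD mulN1r subrr.
have [v00|v00] := eqVneq (v 0 ord0) 0; last first.
  exists (cons2 0 1 0).
  by rewrite cons2_0 cons2_1 tail2_cons2 B0 mul0r mul1r addr0 add0r.
have [v10|v10] := eqVneq (v 0 (lift ord0 ord0)) 0; last first.
  exists (cons2 1 0 0).
  by rewrite cons2_0 cons2_1 tail2_cons2 B0 mul0r mul1r !addr0.
have [w Bw] : exists w, B w (tail2 v) != 0.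
  apply: Bnz; apply: contraNneq v0 => tv0; apply/eqP; rewrite -[v]cons2_tail2.
  rewrite v00 v10 tv0; apply/rowP => j; rewrite !mxE.
  by case: unliftP => [j1|] // _; case: unliftP => [j2|] //; rewrite mxE.
by exists (cons2 0 0 w); rewrite cons2_0 cons2_1 tail2_cons2 !mul0r !add0r.
Qed.

(** Induction through N'(r) = q N(r) + (q - 1) q^(2n+1), the effect of adding a hyperbolic plane. *)
Lemma quadric_count_Qform n c r :
  quadric_count (@Qform F n.*2.+1 c) r
    = #|F|%:R ^+ n.*2 - #|F|%:R ^+ n
      + #|F|%:R ^+ n * \sum_t (- c * t ^+ 2 == r)%:R.
Proof.
elim: n r => [|n IHn] r.
  rewrite subrr add0r mul1r /quadric_count.
  rewrite (reindex (fun t : F => const_mx t : 'rV_1)) /=.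
    by apply: eq_bigr => t _; rewrite Qform1 mxE.
  exists (fun x : 'rV[F]_1 => x 0 0) => [t|x] _; first by rewrite mxE.
  by apply/rowP => j; rewrite !mxE (ord1 j).
transitivity (\sum_a \sum_b quadric_count (@Qform F n.*2.+1 c) (r + a * b)).
  rewrite /quadric_count big_cons2.
  (* The substitution a -> -a reconciles r - a b with r + a b. *)
  rewrite -(sum_affine _ 0 (_ : -1 != 0)) ?oppr_eq0 ?oner_neq0 //.
  apply: eq_bigr => a _; apply: eq_bigr => b _; apply: eq_bigr => y _.
  rewrite Qform_tail2 // cons2_0 cons2_1 tail2_cons2.
  congr (nat_of_bool _)%:R; rewrite -subr_eq0 -[RHS]subr_eq0.
  by congr (_ == _); ring.
rewrite sum_hyperbolic IHn.
have -> : \sum_s quadric_count (@Qform F n.*2.+1 c) s = #|F|%:R ^+ n.*2.+1.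
  by rewrite sum_fibers card_mx mul1n natrX.
by rewrite doubleS !exprS; ring.
Qed.

End StandardForm.

(** * Second moments and the squared incidence error *)

Lemma sqr_sum_le (A : realFieldType) (T : finType) (P : {set T}) (f : T -> A) :
  (\sum_(x in P) f x) ^+ 2 <= #|P|%:R * \sum_(x in P) f x ^+ 2.
Proof.
have [->|P0] := eqVneq P set0; first by rewrite !big_set0 cards0 mul0r expr0n.
set D := \sum_(x in P) f x; set p : A := #|P|%:R.
have p_gt0 : 0 < p by rewrite ltr0n card_gt0.
have : 0 <= \sum_(x in P) (p * f x - D) ^+ 2 by apply: sumr_ge0 => x _; exact: sqr_ge0.
have -> : \sum_(x in P) (p * f x - D) ^+ 2
    = p * (p * (\sum_(x in P) f x ^+ 2) - D ^+ 2).
  rewrite (eq_bigr (fun x => p ^+ 2 * f x ^+ 2 - 2 * p * D * f x + D ^+ 2));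
    last by move=> x _; ring.
  rewrite big_split sumrB /= -!mulr_sumr sumr_const -/D -[_ *+ #|P|]mulr_natl -/p. ring.
by rewrite pmulr_rge0 // subr_ge0.
Qed.

(** Expand the square: diagonal pairs contribute [l] each and off-diagonal pairs at most [m]. Since
    [m] is non-negative, the latter may be counted as |S|^2 pairs. *)
Lemma incidence_variance_le (A : realFieldType) (T U : finType)
    (inc : T -> U -> bool) (S : {set U}) (e l m : A) :
  0 <= m ->
  (forall s, s \in S -> \sum_x (inc x s)%:R = l) ->
  (forall s s', s \in S -> s' \in S -> s != s' ->
     \sum_x (inc x s && inc x s')%:R <= m) ->
  \sum_x (\sum_(s in S) (inc x s)%:R - e) ^+ 2
    <= #|S|%:R * l + #|S|%:R ^+ 2 * m - 2 * e * #|S|%:R * l + #|T|%:R * e ^+ 2.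
Proof.
move=> m0 deg codeg.
under eq_bigr => x _ do rewrite sqrrB.
rewrite big_split sumrB /= sumr_const -[e ^+ 2 *+ _]mulr_natl lerD2r.
have -> : \sum_x ((\sum_(s in S) (inc x s)%:R) * e) *+ 2 = 2 * e * #|S|%:R * l.
  rewrite sumrMnl -mulr_suml exchange_big /= (eq_bigr _ deg) sumr_const.
  by rewrite -mulr_natl; ring.
rewrite lerD2r.
have -> : \sum_x (\sum_(s in S) (inc x s)%:R) ^+ 2
    = \sum_(s in S) \sum_(s' in S) \sum_x (inc x s && inc x s')%:R :> A.
  rewrite [RHS](eq_bigr _ (fun s _ => exchange_big _ _ _ _ _ _)) [RHS]exchange_big.
  apply: eq_bigr => x _; rewrite expr2 mulr_suml; apply: eq_bigr => s _.
  by rewrite mulr_sumr; apply: eq_bigr => s' _; rewrite -natrM mulnb.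
have -> : #|S|%:R * l + #|S|%:R ^+ 2 * m = \sum_(s in S) (l + #|S|%:R * m).
  by rewrite sumr_const -[RHS]mulr_natl; ring.
apply: ler_sum => s sS; rewrite (bigD1 s) //= lerD //.
  by rewrite -(deg _ sS); apply: ler_sum => x _; rewrite andbb.
apply: le_trans (_ : \sum_(s' in S | s' != s) m <= _).
  by apply: ler_sum => s' /andP[s'S ne]; apply: codeg; rewrite // eq_sym.
rewrite big_mkcondr mulr_natl -sumr_const; apply: ler_sum => s' _.
by case: ifP.
Qed.

Lemma incidencesE (A : nzRingType) (F : finFieldType) (d : nat)
    (Q : 'rV[F]_d -> F) (P : {set 'rV[F]_d}) (S : {set Qsphere F d}) :
  (incidences Q P S)%:R
    = \sum_(x in P) \sum_(s in S) (Q (x - Qcenter s) == Qradius s)%:R :> A.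
Proof.
rewrite pair_big /= /incidences -sum1dep_card natr_sum.
rewrite big_mkcond [RHS]big_mkcond; apply: eq_bigr => -[x s] _ /=.
rewrite !inE /=; case: (x \in P); case: (s \in S) => //=. by case: (_ == _).
Qed.

Lemma incidence_error_sqr_le (A : realFieldType) (F : finFieldType) (n : nat) (c : F)
    (P : {set 'rV[F]_n.*2.+1}) (S : {set Qsphere F n.*2.+1}) :
  2 != 0 :> F -> c != 0 ->
  (forall s, s \in S -> Qradius s != 0) ->
  (forall s, s \in S -> ~~ is_square (- (c * Qradius s))) ->
  ((incidences (Qform c) P S)%:R - #|F|%:R^-1 * #|P|%:R * #|S|%:R) ^+ 2
    <= #|P|%:R * (#|F|%:R ^+ n.*2 * #|S|%:R
                  + 3 * (#|F|%:R ^+ n / #|F|%:R) * #|S|%:R ^+ 2) :> A.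
Proof.
move=> two0 c0 rad0 nsq; set q : A := #|F|%:R.
have q_gt0 : 0 < q by rewrite ltr0n ltnW // finNzRing_gt1.
have [B QB] := nondegenerate_Qform n two0 c0.
set e : A := q^-1 * #|S|%:R.
set inc := fun x (s : Qsphere F n.*2.+1) => Qform c (x - Qcenter s) == Qradius s.
have -> : (incidences (Qform c) P S)%:R - q^-1 * #|P|%:R * #|S|%:R
    = \sum_(x in P) (\sum_(s in S) (inc x s)%:R - e).
  by rewrite incidencesE sumrB sumr_const -[e *+ _]mulr_natl /e; congr (_ - _); ring.
apply: le_trans (sqr_sum_le _ _) _; apply: ler_wpM2l; first exact: ler0n.
apply: le_trans (_ : \sum_x (\sum_(s in S) (inc x s)%:R - e) ^+ 2 <= _).
  rewrite big_mkcond; apply: ler_sum => x _.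
  by case: ifP => // _; exact: sqr_ge0.
have deg s : s \in S -> \sum_x (inc x s)%:R = q ^+ n.*2 - q ^+ n.
  move=> sS; rewrite (reindex_inj (addIr (Qcenter s))) /= /inc.
  under eq_bigr do rewrite addrK.
  have := quadric_count_Qform n c (Qradius s).
  rewrite [in RHS]big1 ?mulr0 ?addr0 => [|t _]; last first.
    have [tE|//] := eqVneq.
    by case/existsP: (nsq s sS); exists (c * t); rewrite -tE; apply/eqP; ring.
  rewrite /quadric_count sum_indicator sum_indicator => /(congr1 (intr : int -> A)).
  by rewrite rmorphB !rmorphXn !rmorph_nat.
have m0 : 0 <= q^-1 * (q ^+ n.*2 + q ^+ n).
  by rewrite mulr_ge0 ?invr_ge0 ?addr_ge0 ?exprn_ge0 // ltW.
have codeg s s' : s \in S -> s' \in S -> s != s' ->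
    \sum_x (inc x s && inc x s')%:R <= q^-1 * (q ^+ n.*2 + q ^+ n).
  case: s s' => [y r] [y' r'] sS s'S; have := nsq _ sS; have := rad0 _ sS.
  rewrite /Qradius /= => r0 rnsq ne.
  have [yy|yy] := eqVneq y y'.
    rewrite big1 => [|x _]; first exact: m0.
    rewrite /inc -yy /Qcenter /Qradius /=; case: eqP => //= ->.
    by case: eqP => // rr; rewrite yy rr eqxx in ne.
  (* With the origin moved to y, the difference of the two equations is linear: B(x, y - y') = r' -
     r - Q(y - y'). *)
  have -> : \sum_x (inc x (y, r) && inc x (y', r'))%:R
      = (section_count (Qform c) B (y - y') r (r' - r - Qform c (y - y')))%:~R :> A.
    rewrite rmorph_sum /= (reindex_inj (addIr y)); apply: eq_bigr => x _ /=.
    rewrite rmorph_nat /inc /Qcenter /Qradius /= addrK -addrA.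
    rewrite -[y - y' in LHS]scale1r (quadD QB) mul1r expr1n mul1r.
    case: (Qform c x =P r) => //= ->; congr (nat_of_bool _)%:R.
    by rewrite -subr_eq0 -[RHS]subr_eq0; congr (_ == _); ring.
  rewrite ler_pdivlMl //.
  have vv : y - y' != 0 by rewrite subr_eq0.
  have := section_count_le QB two0 c0 erefl (quadric_count_Qform n c)
    (r' - r - Qform c (y - y')) vv r0 rnsq.
  by rewrite -(ler_int A) rmorphM rmorphD !rmorphXn !rmorph_nat.
apply: le_trans (incidence_variance_le _ m0 deg codeg) _.
rewrite card_mx mul1n natrX -/q /e -subr_ge0.
(* The terms q^(2n-1) |S|^2 cancel as 1 - 2 + 1, while q^(n-1) |S|^2 occurs 1 + 2 = 3 times; the
   slack comes from the -q^n in the size of a sphere. *)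
rewrite (_ : _ - _ = q ^+ n * #|S|%:R); first by rewrite mulr_ge0 ?exprn_ge0 // ltW.
by rewrite [q ^+ _.+1]exprS; field; rewrite lt0r_neq0.
Qed.

(** * From the character condition and the squared bound to real exponents *)

Theorem theorem1p9 (R : realType) (q : nat) (F : finFieldType)
  (hFq : #|F| = q) (hq : odd q)
  (eps : F) (heps : ~~ is_square eps)
  (d : nat) (hd : odd d)
  (i : nat) (hi : i \in [:: 3; 4]%N)
  (Rad : {set F}) (hRad0 : forall r, r \in Rad -> r != 0)
  (hRad : forall r, r \in Rad -> (-1) ^+ i.+1 * eta (- r) = -1)
  (P : {set 'rV[F]_d}) (S : {set Qsphere F d})
  (hS : forall s, s \in S -> Qradius s \in Rad) :
  `| (incidences (Qi eps i) P S)%:R - q%:R^-1 * #|P|%:R * #|S|%:R |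
  <= q%:R `^ ((d%:R - 1) / 2) * #|P|%:R `^ 2^-1 * #|S|%:R `^ 2^-1
     + Num.sqrt 3 * q%:R `^ ((d%:R - 3) / 4) * #|P|%:R `^ 2^-1 * #|S|%:R
  :> R.
Proof.
have two0 : 2 != 0 :> F by apply: odd_card_two_neq0; rewrite hFq.
have eps0 : eps != 0.
  by apply: contraNneq heps => ->; apply/existsP; exists 0; rewrite expr0n.
have [c [c0 QiE nsq]] : exists c, [/\ c != 0, Qi eps i = @Qform F d c
    & forall r, r \in Rad -> ~~ is_square (- (c * r))].
  have etaN r : r \in Rad -> eta (- r) = if is_square (- r) then 1 else -1.
    by move=> /hRad0 r0; rewrite /eta oppr_eq0 (negPf r0).
  move: hi hRad; rewrite !inE => /orP[] /eqP -> hRad1.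
    exists 1; split=> // [|r rR]; first exact: oner_neq0.
    by have := hRad1 r rR; rewrite etaN // mul1r; case: ifP.
  (* For i = 4 the sign is reversed, so -r = y^2 is a square; if also -(eps r) = z^2, then eps = (z
     / y)^2. *)
  exists eps; split=> // r rR; have := hRad1 r rR; rewrite etaN //.
  case: ifP => // /existsP[y /eqP yE] _; apply: contra heps => /existsP[z /eqP zE].
  have y0 : y != 0 by rewrite -sqrf_eq0 -yE oppr_eq0 hRad0.
  apply/existsP; exists (z / y).
  by rewrite expr_div_n -zE -yE -mulrN mulfK // oppr_eq0 hRad0.
rewrite QiE -hFq; set Q := #|F|%:R : R.
have [n dE] : exists n, d = n.*2.+1 by exists d./2; rewrite -[LHS]odd_double_half hd.
subst d.
have rad0 s : s \in S -> Qradius s != 0 by move=> /hS /hRad0.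
have radnsq s : s \in S -> ~~ is_square (- (c * Qradius s)) by move=> /hS /nsq.
have := incidence_error_sqr_le R P two0 c0 rad0 radnsq.
rewrite -/Q; set D := _ - _; set p : R := #|P|%:R; set t : R := #|S|%:R => sqD.
have Q_gt0 : 0 < Q by rewrite ltr0n ltnW // finNzRing_gt1.
(* As d = 2n + 1, the exponents are n and (n - 1)/2; the square of [b] is written [Q ^+ n / Q]
   because n may be 0. *)
set a := Q `^ _; set b := Q `^ _.
have aE : a ^+ 2 = Q ^+ n.*2.
  rewrite -!powR_mulrn ?powR_ge0 ?ltW // -powRrM; congr (_ `^ _).
  by rewrite -addn1 natrD addrK divfK // pnatr_eq0.
have bE : b ^+ 2 = Q ^+ n / Q.
  rewrite -powR_inv1 -?powR_mulrn ?powR_ge0 ?ltW // -powRrM -powRD.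
    by congr (_ `^ _); rewrite -addn1 -muln2 natrD natrM; field.
  by rewrite (lt0r_neq0 Q_gt0) implybT.
have a0 : 0 <= a := powR_ge0 _ _.
have b0 : 0 <= b := powR_ge0 _ _.
have pE : (p `^ 2^-1) ^+ 2 = p by rewrite powR12_sqrt ?sqr_sqrtr // ler0n.
have tE : (t `^ 2^-1) ^+ 2 = t by rewrite powR12_sqrt ?sqr_sqrtr // ler0n.
have s3E : (Num.sqrt 3) ^+ 2 = 3 :> R by rewrite sqr_sqrtr // ler0n.
have s30 : 0 <= Num.sqrt 3 :> R := sqrtr_ge0 _.
have p0 : 0 <= p `^ 2^-1 := powR_ge0 _ _.
have t0 : 0 <= t `^ 2^-1 := powR_ge0 _ _.
have T0 : 0 <= t := ler0n _ _.
set x := a * _ * _; set y := _ * t.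
have x0 : 0 <= x by rewrite !mulr_ge0.
have y0 : 0 <= y by rewrite !mulr_ge0.
rewrite -ler_sqr ?nnegrE ?addr_ge0 // real_normK ?num_real //.
apply: le_trans sqD _; rewrite sqrrD.
(* The squared bound is x^2 + y^2, and (x + y)^2 exceeds it by 2 x y, which is non-negative. *)
have -> : p * (Q ^+ n.*2 * t + 3 * (Q ^+ n / Q) * t ^+ 2) = x ^+ 2 + y ^+ 2.
  by rewrite /x /y !exprMn aE bE pE tE s3E; ring.
by rewrite lerD2r lerDl mulrn_wge0 // mulr_ge0.
Qed.
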